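(* Let $\theta>1$. For all integers $k,m\ge 0$, $$\frac{2}{\sqrt{\theta^2-1}}\int_{\mathbb{C}}H_k(z)\overline{H_m(z)}\exp\left[-\frac{2(\operatorname{Re} z)^2}{\theta+1}-\frac{2(\operatorname{Im} z)^2}{\theta-1}\right]d\sigma(z)=\delta_{k,m}\,\pi\,(2\theta)^k\,k!.$$
   Context: $H_k$ is the $k$-th Hermite polynomial in the standard (physicists') normalization, $H_k(x)=(-1)^ke^{x^2}\frac{d^k}{dx^k}e^{-x^2}$, so that $\int_{-\infty}^\infty H_k(x)H_m(x)e^{-x^2}dx=\delta_{k,m}\sqrt{\pi}\,2^kk!$. $d\sigma$ is Lebesgue area measure on $\mathbb{C}$ and $\delta_{k,m}$ is the Kronecker delta. *)

(* Defs.v *)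
From mathcomp Require Import all_boot all_order all_algebra.
From mathcomp Require Import all_classical all_reals all_analysis.
From mathcomp Require Export complex.
From mathcomp Require Import ring.
Set Implicit Arguments.
Unset Strict Implicit.
Unset Printing Implicit Defensive.
Import Order.TTheory GRing.Theory Num.Theory.
Import numFieldNormedType.Exports.
Local Open Scope classical_set_scope.
Local Open Scope ring_scope.
Local Open Scope complex_scope.

Lemma hermite_exists (R : realType) (k : nat) :
  exists p : {poly R}, forall x : R,
    p.[x] = (-1) ^+ k * expR (x ^+ 2)
            * ((fun t : R => expR (- t ^+ 2))^`(k))%classic x.
Proof.
suff [p Hp] : exists p : {poly R}, ((fun t : R => expR (- t ^+ 2))^`(k))%classic =
    (fun x => (-1) ^+ k * (p.[x] * expR (- x ^+ 2))).
  exists p => x; rewrite Hp.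
  rewrite mulrACA -expr2 sqrr_sign mul1r mulrCA -expRD subrr.
  by rewrite expR0 mulr1.
elim: k => [|k [p Hp]].
  by exists 1; apply/funext => x; rewrite derive1n0 !hornerE.
exists (2 *: 'X * p - deriv p); rewrite derive1nS Hp; apply/funext => x.
have dg : is_derive x (1 : R) (fun t : R => expR (- t ^+ 2))
    (expR (- x ^+ 2) * (- (2 * x))).
  apply: (is_derive1_comp (f := expR) (g := fun t : R => - t ^+ 2)).
  have -> : (fun t : R => - t ^+ 2) = horner (- 'X^2).
    by apply/funext => t; rewrite !hornerE.
  apply: is_derive_eq.
  by rewrite derivN derivXn !hornerE /= mulr_natl.
have dp := is_derive_poly p x.
have dM := is_deriveM dp dg.
have dZ := is_deriveZ ((-1) ^+ k) dM.
rewrite derive1E.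
transitivity ('D_1 ((-1) ^+ k \*: (horner p * (fun t : R => expR (- t ^+ 2)))) x).
  by [].
have -> : (2 *: 'X * p - deriv p).[x] = 2 * x * p.[x] - (deriv p).[x].
  by rewrite !hornerE.
rewrite derive_val /GRing.scale /= [(-1) ^+ k.+1]exprS.
ring.
Qed.

(* Physicists' normalization: the Rodrigues formula on the real line determines
   the polynomial, which is then evaluated at complex points by [hermiteC]. *)
Definition hermite (R : realType) (k : nat) : {poly R} :=
  sval (cid (hermite_exists R k)).

Definition hermiteC (R : realType) (k : nat) (z : R[i]) : R[i] :=
  (map_poly (real_complex R) (hermite R k)).[z].

(* Integration over C with respect to area measure: C is identified with R * R
   through (x, y) |-> x + i y, and a complex-valued function is integrated
   componentwise. [Rintegral] has a junk value on non-integrable functions, so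
   [cintegral] is meaningful only under [cintegrable]. *)
Definition area_measure (R : realType) :
    {measure set (measurableTypeR R * measurableTypeR R) -> \bar R} :=
  (@lebesgue_measure R \x @lebesgue_measure R)%E.

Definition cintegrable (R : realType) (f : R[i] -> R[i]) : Prop :=
  (area_measure R).-integrable setT
    (fun w : R * R => (complex.Re (f (w.1 +i* w.2)))%:E) /\
  (area_measure R).-integrable setT
    (fun w : R * R => (complex.Im (f (w.1 +i* w.2)))%:E).

Definition cintegral (R : realType) (f : R[i] -> R[i]) : R[i] :=
  Rintegral (area_measure R) setT
    (fun w : R * R => complex.Re (f (w.1 +i* w.2)))
  +i* Rintegral (area_measure R) setT
    (fun w : R * R => complex.Im (f (w.1 +i* w.2))).

(* Main.v *)
Require Import Defs.
From mathcomp Require Import all_boot all_order all_algebra.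
From mathcomp Require Import all_classical all_reals all_analysis.
From mathcomp Require Import measurable_realfun ring polyXY.
Set Implicit Arguments.
Unset Strict Implicit.
Unset Printing Implicit Defensive.
Import Order.TTheory GRing.Theory Num.Theory.
Import numFieldNormedType.Exports.
Local Open Scope classical_set_scope.
Local Open Scope ring_scope.
Local Open Scope complex_scope.

(** Put [a = 2 / (theta + 1)] and [b = 2 / (theta - 1)], so that
    [1/a - 1/b = 1] and [1/a + 1/b = theta].  Integration by parts against the
    weight [w = exp (- a x^2 - b y^2)] replaces multiplication by [2 a x] and
    [2 b y] by the partial derivatives in [x] and [y].  On a product
    [F(z) G(conj z)] of polynomials, multiplication by [2 z] therefore becomes
    [(1/a - 1/b) F' G + (1/a + 1/b) F G'], that is,
    [\int (2 z F - F')(z) G(conj z) w = theta \int F(z) G'(conj z) w].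
    With [H_(k+1) = 2 X H_k - H_k'] and [H_m' = 2 m H_(m-1)] this lowers both
    indices at once, and what remains is the Gaussian integral of [w]. *)

(** * One-dimensional Gaussian integrals and integration by parts *)

Section Gaussian.
Context {R : realType}.
Local Notation mu := (@lebesgue_measure R).

Definition gaussian (a x : R) : R := expR (- (a * x ^+ 2)).

Let sd (a : R) := Num.sqrt ((2 * a)^-1).

(** A centred normal density of variance [1 / (2 a)] has exponent [- a x^2] and peak
    [1 / sqrt (pi / a)]. Integrability and total mass of the Gaussian thus follow from those of the
    normal law. *)
Lemma gaussian_normal_pdf (a x : R) : 0 < a ->
  gaussian a x = Num.sqrt (pi / a) * normal_pdf 0 (sd a) x.
Proof.
move=> a0; have a2 : 0 < (2 * a)^-1 by rewrite invr_gt0 mulr_gt0.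
have s2 : sd a ^+ 2 = (2 * a)^-1 by rewrite sqr_sqrtr// ltW.
have s0 : sd a != 0 by rewrite gt_eqF// sqrtr_gt0.
rewrite normal_pdfE// /normal_peak /normal_fun subr0 s2.
have -> : (2 * a)^-1 * pi *+ 2 = pi / a by field; rewrite gt_eqF.
rewrite mulrA divff ?mul1r; last first.
  by rewrite gt_eqF// sqrtr_gt0 divr_gt0// pi_gt0.
congr expR; field; by rewrite gt_eqF.
Qed.

Lemma integrable_gaussian (a : R) : 0 < a ->
  mu.-integrable setT (EFin \o gaussian a).
Proof.
move=> a0.
apply: (eq_integrable measurableT); last first.
  exact: (integrableZl measurableT (Num.sqrt (pi / a))
    (integrable_normal_pdf 0 (sd a))).
by move=> x _ /=; rewrite gaussian_normal_pdf// EFinM.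
Qed.

Lemma Rintegral_gaussian (a : R) : 0 < a ->
  \int[mu]_x gaussian a x = Num.sqrt (pi / a).
Proof.
move=> a0; under eq_Rintegral do rewrite gaussian_normal_pdf//.
rewrite RintegralZl//; last exact: integrable_normal_pdf.
by rewrite /Rintegral integral_normal_pdf /= mulr1.
Qed.

Lemma continuous_gaussian (a : R) : continuous (gaussian a).
Proof.
move=> x; apply: (@continuous_comp _ _ _ (fun x : R => - (a * x ^+ 2)) expR).
  apply: cvgN; apply: cvgM; first exact: cvg_cst.
  exact: exprn_continuous.
exact: continuous_expR.
Qed.

Lemma continuous_monomial_gaussian (a : R) (n : nat) :
  continuous (fun x : R => x ^+ n * gaussian a x).
Proof.
move=> x; apply: cvgM; first exact: exprn_continuous.
exact: continuous_gaussian.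
Qed.

(** Half of the exponent suffices to absorb the monomial, since [|x|^n <= n! exp |x|] and
    [|x| - a x^2 / 2] is bounded above. This one bound yields both integrability and decay at
    infinity. *)
Lemma monomial_gaussian_le (a : R) (n : nat) : 0 < a ->
  exists2 c : R, 0 <= c &
    forall x, `|x ^+ n * gaussian a x| <= c * gaussian (a / 2) x.
Proof.
move=> a0; exists (n`!%:R * expR (2 * a)^-1).
  by rewrite mulr_ge0// expR_ge0.
move=> x; rewrite normrM normrX [`|gaussian _ _|]ger0_norm ?expR_ge0//.
have xn : `|x| ^+ n <= n`!%:R * expR `|x|.
  case: n => [|n]; first by rewrite expr0 fact0 mul1r -expR0 ler_expR.
  rewrite -ler_pdivrMl ?ltr0n ?fact_gt0// mulrC.
  by apply: le_trans (expR_ge1Dxn n (normr_ge0 x)); rewrite lerDr.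
apply: le_trans (ler_wpM2r (expR_ge0 _) xn) _.
rewrite -!mulrA ler_wpM2l//  -!expRD ler_expR.
have -> : x ^+ 2 = `|x| ^+ 2 by rewrite real_normK// num_real.
(* Completing the square: the maximum [1 / (2 a)] of [|x| - a x^2 / 2] is attained at
   [|x| = 1 / a]. *)
have -> : (2 * a)^-1 - a / 2 * `|x| ^+ 2 =
  `|x| - a * `|x| ^+ 2 + a / 2 * (`|x| - a^-1) ^+ 2 by field; rewrite gt_eqF.
by rewrite lerDl mulr_ge0 ?sqr_ge0// divr_ge0// ltW.
Qed.

Lemma integrable_monomial_gaussian (a : R) (n : nat) : 0 < a ->
  mu.-integrable setT (fun x => (x ^+ n * gaussian a x)%:E).
Proof.
move=> a0; have [c c0 cP] := monomial_gaussian_le n a0.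
have a20 : 0 < a / 2 by rewrite divr_gt0.
have ic : mu.-integrable setT (fun x => (c * gaussian (a / 2) x)%:E).
  exact: (integrableZl measurableT c (integrable_gaussian a20)).
apply: le_integrable ic => //.
  apply/measurable_EFinP; apply: continuous_measurable_fun.
  exact: continuous_monomial_gaussian.
move=> x _; rewrite !abse_EFin lee_fin.
by apply: le_trans (cP x) _; rewrite ler_norm.
Qed.

(** The fundamental theorem of calculus on growing symmetric intervals leaves only boundary terms,
    which vanish in the limit; dominated convergence, with [|f|] as dominant, identifies that limit
    with the full integral. *)
Lemma Rintegral_deriv0 (f F : R -> R) :
  continuous f -> mu.-integrable setT (EFin \o f) ->
  (forall x, is_derive x (1 : R) F (f x)) ->
  (fun n : nat => F n%:R) @ \oo --> (0 : R) ->
  (fun n : nat => F (- n%:R)) @ \oo --> (0 : R) ->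
  \int[mu]_x f x = 0.
Proof.
move=> cf intf dF Fy FNy.
(* The successor keeps every interval nondegenerate, as [continuous_FTC2] requires. *)
pose I (n : nat) : set R := `[- n.+1%:R, n.+1%:R]%classic.
have mf : measurable_fun setT (EFin \o f) by exact: measurable_int intf.
have IE n : (\int[mu]_(x in I n) (f x)%:E = (F n.+1%:R - F (- n.+1%:R))%:E)%E.
  have cF : continuous F.
    move=> x; apply: differentiable_continuous.
    by apply/derivable1_diffP; case: (dF x).
  rewrite EFinB; apply: continuous_FTC2.
  - by rewrite gtrN.
  - by apply: continuous_subspaceT.
  - split.
    + by move=> x _; case: (dF x).
    + exact/cvg_at_right_filter/cF.
    + exact/cvg_at_left_filter/cF.
  - by move=> x _; rewrite derive1E; case: (dF x).
have lim1 : (\int[mu]_(x in I n) (f x)%:E)%E @[n --> \oo] --> 0%E.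
  under eq_fun do rewrite IE.
  apply: cvg_EFin; first by near=> n.
  rewrite -[X in _ --> X]subr0; apply: cvgB.
    by rewrite -cvg_shiftS in Fy.
  by rewrite -cvg_shiftS in FNy.
have mI n : measurable (I n) by exact: measurable_itv.
have lim2 : (\int[mu]_(x in I n) (f x)%:E)%E @[n --> \oo] -->
    (\int[mu]_x (f x)%:E)%E.
  under eq_fun do rewrite integral_mkcond.
  apply: (@dominated_cvg _ _ _ mu setT measurableT
    (fun n => (EFin \o f) \_ (I n)) (EFin \o f) (abse \o (EFin \o f))) => //.
  - by move=> n; apply: (measurable_restrictT _ (mI n)).1; exact: measurable_funTS mf.
  (* Each point lies in all [I n] with [n >= |x|], so the truncations are eventually constant
     there. *)
  - move=> x _; apply: cvg_near_cst; near=> n.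
    rewrite /patch mem_set// /I /= in_itv /= -ler_norml.
    apply: (@le_trans _ _ n%:R); last by rewrite ler_nat.
    by near: n; exact: nbhs_infty_ger.
  - exact: integrable_abse.
  - by move=> n x _; rewrite /patch; case: ifP => _; rewrite ?lexx// abse0 abse_ge0.
by rewrite /Rintegral (cvg_unique _ lim2 lim1)//.
Unshelve. all: end_near. Qed.

(** The uniform bound for the exponent [n + 1], divided by [|x|], gives decay like [c / |x|]. The
    sign [s] serves both ends of the line. *)
Lemma cvg_monomial_gaussian (a : R) (n : nat) (s : R) : 0 < a -> `|s| = 1 ->
  (fun k : nat => (s * k%:R) ^+ n * gaussian a (s * k%:R)) @ \oo --> (0 : R).
Proof.
move=> a0 s1; have [c c0 cP] := monomial_gaussian_le n.+1 a0.
have ub (k : nat) : `|(s * k.+1%:R) ^+ n * gaussian a (s * k.+1%:R)|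
    <= c * k.+1%:R^-1.
  rewrite ler_pdivlMr ?ltr0n//.
  have kE : k.+1%:R = `|s * k.+1%:R| :> R by rewrite normrM s1 mul1r normr_nat.
  rewrite [X in _ * X <= _]kE -normrM mulrAC -exprSr; apply: le_trans (cP _) _.
  rewrite ler_piMr// -expR0 ler_expR oppr_le0 mulr_ge0 ?sqr_ge0//.
  by rewrite divr_ge0 // ltW.
have lim0 : (fun k : nat => c * k.+1%:R^-1) @ \oo --> (0 : R).
  by rewrite -[X in _ --> X](mulr0 c); apply: cvgM;
    [exact: cvg_cst|exact: cvg_harmonic].
rewrite -cvg_shiftS; apply: norm_cvg0.
apply: (squeeze_cvgr _ (cvg_cst 0) lim0).
by near=> k; rewrite normr_ge0 /= ub.
Unshelve. all: end_near. Qed.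

(** The difference of the two sides is the integral of the derivative of [x^n exp (- a x^2)]. At
    [n = 0] the truncated [n.-1] is harmless because its coefficient is zero. *)
Lemma Rintegral_monomial_gaussian_rec (a : R) (n : nat) : 0 < a ->
  2 * a * \int[mu]_x (x ^+ n.+1 * gaussian a x) =
  n%:R * \int[mu]_x (x ^+ n.-1 * gaussian a x).
Proof.
move=> a0.
have i1 := integrable_monomial_gaussian n.+1 a0.
have i2 := integrable_monomial_gaussian n.-1 a0.
apply/eqP; rewrite eq_sym -subr_eq0; apply/eqP.
rewrite -!RintegralZl// -RintegralB//; last 2 first.
- exact: (integrableZl measurableT n%:R i2).
- exact: (integrableZl measurableT (2 * a) i1).
apply: (@Rintegral_deriv0 _ (fun x => x ^+ n * gaussian a x)).
- by move=> x; apply: cvgB; apply: cvgM; try exact: cvg_cst;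
  exact: continuous_monomial_gaussian.
- exact: (integrableB measurableT
    (integrableZl measurableT n%:R i2)
    (integrableZl measurableT (2 * a) i1)).
- move=> x.
  have dg : is_derive x (1 : R) (gaussian a) (gaussian a x * (- (2 * a * x))).
    apply: (is_derive1_comp (f := expR) (g := fun t : R => - (a * t ^+ 2))).
    have -> : (fun t : R => - (a * t ^+ 2)) = horner (- (a *: 'X^2)).
      by apply/funext => t; rewrite !hornerE.
    apply: is_derive_eq.
    by rewrite derivN derivZ derivXn !hornerE /=; ring.
  have -> : (fun x : R => x ^+ n * gaussian a x) = (horner 'X^n * gaussian a).
    by apply/funext => t; rewrite mulrfctE hornerXn.
  have dp := is_derive_poly ('X^n : {poly R}) x.
  apply: is_derive_eq (is_deriveM dp dg) _.
  rewrite derivXn hornerMn !hornerXn exprS /GRing.scale /=; ring.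
- under eq_fun do rewrite -[_%:R]mul1r.
  by apply: cvg_monomial_gaussian; rewrite ?normr1.
- under eq_fun do rewrite -mulN1r.
  by apply: cvg_monomial_gaussian; rewrite ?normrN1.
Qed.

End Gaussian.

(** * Fubini for products of functions in separate variables *)

Section ProductIntegral.
Context d1 d2 (T1 : measurableType d1) (T2 : measurableType d2) (R : realType).
Variables (m1 : {sigma_finite_measure set T1 -> \bar R})
  (m2 : {sigma_finite_measure set T2 -> \bar R}) (f : T1 -> R) (g : T2 -> R).
Hypothesis intf : m1.-integrable setT (fun x => (f x)%:E).
Hypothesis intg : m2.-integrable setT (fun y => (g y)%:E).

Lemma integrable_tensor :
  (m1 \x m2)%E.-integrable setT (fun w => (f w.1 * g w.2)%:E).
Proof.
have [/measurable_EFinP mf _] := integrableP _ _ _ intf.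
have [/measurable_EFinP mg _] := integrableP _ _ _ intg.
have mfg : measurable_fun setT (fun w : T1 * T2 => (f w.1 * g w.2)%:E).
  apply/measurable_EFinP; apply: measurable_funM.
    exact: (measurableT_comp mf measurable_fst).
  exact: (measurableT_comp mg measurable_snd).
(* Tonelli: finiteness of the iterated integral of the absolute value is enough, and its inner
   integral is a constant times [|f x|]. *)
apply/(integrable12ltyP m1 m2 mfg).
have nf : m1.-integrable setT (fun x => `|f x|%:E) := integrable_norm intf.
have ng : m2.-integrable setT (fun y => `|g y|%:E) := integrable_norm intg.
have Ig := fineK (integrable_fin_num measurableT ng).
have If := fineK (integrable_fin_num measurableT nf).
have inner x : (\int[m2]_y `|(f x * g y)%:E| =
    (\int[m2]_y `|g y|)%:E * `|f x|%:E)%E.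
  under eq_integral => y _ do rewrite abse_EFin normrM EFinM.
  by rewrite (integralZl measurableT ng) -Ig muleC.
rewrite (eq_integral (fun x => (\int[m2]_y `|g y|)%:E * `|f x|%:E)%E); last first.
  by move=> x _; rewrite -inner.
by rewrite (integralZl measurableT nf) -If -EFinM ltry.
Qed.

Lemma Rintegral_tensor :
  Rintegral (m1 \x m2)%E setT (fun w => f w.1 * g w.2) =
  (\int[m1]_x f x) * (\int[m2]_y g y).
Proof.
have If := fineK (integrable_fin_num measurableT intf).
have Ig := fineK (integrable_fin_num measurableT intg).
have inner x : (\int[m2]_y (f x * g y)%:E =
    (\int[m2]_y g y)%:E * (f x)%:E)%E.
  under eq_integral => y _ do rewrite EFinM.
  by rewrite (integralZl measurableT intg) -Ig muleC.
rewrite {1}/Rintegral -(integral12_prod_meas1 integrable_tensor).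
rewrite (eq_integral (fun x => (\int[m2]_y g y)%:E * (f x)%:E)%E); last first.
  by move=> x _; rewrite -inner.
by rewrite (integralZl measurableT intf) -If -EFinM /= mulrC.
Qed.

End ProductIntegral.

(** * Linearity of the area integral on the complex plane *)

Section ComplexIntegral.
Context {R : realType}.
Implicit Types (f g : R[i] -> R[i]) (c : R[i]).

Lemma cintegrableD f g :
  cintegrable f -> cintegrable g -> cintegrable (fun z => f z + g z).
Proof.
move=> [fr fi] [gr gi]; split.
- apply: (eq_integrable measurableT) (integrableD measurableT fr gr) => w _ /=.
  by case: (f _) (g _) => [? ?] [? ?].
- apply: (eq_integrable measurableT) (integrableD measurableT fi gi) => w _ /=.
  by case: (f _) (g _) => [? ?] [? ?].
Qed.

Lemma cintegralD f g : cintegrable f -> cintegrable g ->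
  cintegral (fun z => f z + g z) = cintegral f + cintegral g.
Proof.
move=> [fr fi] [gr gi]; rewrite /cintegral.
apply/eqP; rewrite eq_complex /= -!RintegralD//; apply/andP; split; apply/eqP.
- by apply: eq_Rintegral => w _; case: (f _) (g _) => [? ?] [? ?].
- by apply: eq_Rintegral => w _; case: (f _) (g _) => [? ?] [? ?].
Qed.

Lemma cintegrableZ c f : cintegrable f -> cintegrable (fun z => c * f z).
Proof.
case: c => cr ci [fr fi]; split.
- apply: (eq_integrable measurableT) (integrableB measurableT
    (integrableZl measurableT cr fr) (integrableZl measurableT ci fi)) => w _ /=.
  by case: (f _).
- apply: (eq_integrable measurableT) (integrableD measurableT
    (integrableZl measurableT cr fi) (integrableZl measurableT ci fr)) => w _ /=.
  by case: (f _).
Qed.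

Lemma cintegralZ c f : cintegrable f ->
  cintegral (fun z => c * f z) = c * cintegral f.
Proof.
case: c => cr ci [fr fi]; rewrite /cintegral.
apply/eqP; rewrite eq_complex /= -!RintegralZl//.
rewrite -RintegralB//; last 2 first.
- exact: (integrableZl measurableT cr fr).
- exact: (integrableZl measurableT ci fi).
rewrite -RintegralD//; last 2 first.
- exact: (integrableZl measurableT cr fi).
- exact: (integrableZl measurableT ci fr).
apply/andP; split; apply/eqP; by apply: eq_Rintegral => w _; case: (f _).
Qed.

Section Tensor.
Variables (u v : R -> R).
Hypothesis intu : (@lebesgue_measure R).-integrable setT (fun x => (u x)%:E).
Hypothesis intv : (@lebesgue_measure R).-integrable setT (fun y => (v y)%:E).

Lemma cintegrable_tensor :
  cintegrable (fun z : R[i] => (u (complex.Re z) * v (complex.Im z))%:C).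
Proof.
split => /=; first exact: integrable_tensor intu intv.
exact: integrable0.
Qed.

Lemma cintegral_tensor :
  cintegral (fun z : R[i] => (u (complex.Re z) * v (complex.Im z))%:C) =
  (Rintegral lebesgue_measure setT u * Rintegral lebesgue_measure setT v)%:C.
Proof.
rewrite /cintegral /= -(Rintegral_tensor intu intv).
by congr Complex; rewrite /Rintegral integral0.
Qed.

End Tensor.
End ComplexIntegral.

(** * Bivariate polynomials and their partial derivatives *)

Section BivariatePolynomials.
Context {C : comNzRingType}.
Implicit Types (P Q : {poly {poly C}}) (F : {poly C}).

(** A bivariate polynomial is a finite sum of monomials, so an identity linear in [P] needs checking
    on monomials only. *)
Lemma poly2_ind (K : {poly {poly C}} -> Prop) :
  K 0 -> (forall P Q, K P -> K Q -> K (P + Q)) ->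
  (forall c i j, K ((c *: 'X^i) *: 'X^j)) -> forall P, K P.
Proof.
move=> K0 KD KM P; rewrite -[P]coefK poly_def.
apply: (big_ind K) => // j _; rewrite -[P`_j]coefK poly_def scaler_suml.
by apply: (big_ind K) => // i _; exact: KM.
Qed.

(** The partial derivative in the inner variable; [deriv] itself is the one in the outer
    variable. *)
Definition derivY P : {poly {poly C}} := map_poly deriv P.

Lemma derivYD P Q : derivY (P + Q) = derivY P + derivY Q.
Proof. by rewrite /derivY raddfD. Qed.

Lemma derivYM P Q : derivY (P * Q) = derivY P * Q + P * derivY Q.
Proof.
apply/polyP => k; rewrite coefD !coefM coef_map coefM raddf_sum -big_split /=.
by apply: eq_bigr => i _; rewrite derivM !coef_map.
Qed.

Lemma derivYZ (p : {poly C}) n : derivY (p *: 'X^n) = p^`() *: 'X^n.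
Proof.
apply/polyP => k; rewrite coef_map !coefZ !coefXn.
by case: eqP => _ /=; rewrite ?mulr1 // !mulr0 raddf0.
Qed.

Lemma derivYX : derivY ('X : {poly {poly C}}) = 0.
Proof. by have := derivYZ 1 1; rewrite expr1 scale1r derivC scale0r. Qed.

Lemma derivYC (p : {poly C}) : derivY p%:P = p^`()%:P.
Proof. by rewrite /derivY map_polyC. Qed.

Section ChainRule.
Variable D : {poly {poly C}} -> {poly {poly C}}.
Hypothesis DD : forall P Q, D (P + Q) = D P + D Q.
Hypothesis DM : forall P Q, D (P * Q) = D P * Q + P * D Q.
Hypothesis DC : forall c : C, D c%:P%:P = 0.

(** Induction along Horner's scheme uses only additivity, the Leibniz rule and the vanishing on
    constants, so an abstract derivation [D] covers both partial derivatives. *)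
Lemma derivation_comp_poly F Q :
  D (F^:P \Po Q) = (F^`()^:P \Po Q) * D Q.
Proof.
elim/poly_ind: F => [|F c IH].
  by rewrite deriv0 rmorph0 comp_poly0 mul0r; have := DC 0; rewrite !polyC0.
rewrite derivD derivC addr0 derivM derivX mulr1.
rewrite !(rmorphD, rmorphM) /= !map_polyX map_polyC /=.
by rewrite ?comp_polyD ?comp_polyM !comp_polyX !comp_polyC DD DM IH DC; ring.
Qed.

End ChainRule.
End BivariatePolynomials.

(** * Moments of polynomials under the two-dimensional Gaussian weight *)

Section GaussianFunctional.
Context {R : realType}.
Variables a b : R.
Hypothesis a0 : 0 < a.
Hypothesis b0 : 0 < b.
Implicit Types (P Q : {poly {poly R[i]}}) (F G : {poly R[i]}).

Definition gauss_weight (z : R[i]) : R :=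
  gaussian a (complex.Re z) * gaussian b (complex.Im z).

(* The outer variable of [P] is evaluated at [Re z], the inner one at [Im z]. *)
Definition gauss_poly P (z : R[i]) : R[i] :=
  P.[(complex.Re z)%:C, (complex.Im z)%:C] * (gauss_weight z)%:C.

Definition gauss_moment P : R[i] := cintegral (gauss_poly P).

Let moment (c : R) (n : nat) : R :=
  Rintegral lebesgue_measure setT (fun x : R => x ^+ n * gaussian c x).

Lemma gauss_polyD P Q : gauss_poly (P + Q) = fun z => gauss_poly P z + gauss_poly Q z.
Proof. by apply/funext => z; rewrite /gauss_poly !hornerE mulrDl. Qed.

Lemma gauss_polyZ (c : R[i]) P :
  gauss_poly (c%:P *: P) = fun z => c * gauss_poly P z.
Proof. by apply/funext => z; rewrite /gauss_poly !hornerE. Qed.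

Lemma gauss_poly_monomial (c : R[i]) i j :
  gauss_poly ((c *: 'X^j) *: 'X^i) = fun z =>
    c * (complex.Re z ^+ i * gaussian a (complex.Re z) *
        (complex.Im z ^+ j * gaussian b (complex.Im z)))%:C.
Proof.
apply/funext => z; rewrite /gauss_poly /gauss_weight !(hornerE, hornerXn).
by rewrite !rmorphM !rmorphXn /=; ring.
Qed.

Lemma cintegrable_gauss_poly P : cintegrable (gauss_poly P).
Proof.
move: P; apply: poly2_ind => [|P Q IP IQ|c i j].
- have -> : gauss_poly 0 = fun=> 0.
    by apply/funext => z; rewrite /gauss_poly !horner0 mul0r.
  by split; exact: integrable0.
- by rewrite gauss_polyD; exact: cintegrableD.
- rewrite gauss_poly_monomial; apply: cintegrableZ; 
  exact: cintegrable_tensor (integrable_monomial_gaussian j a0)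
    (integrable_monomial_gaussian i b0).
Qed.

Lemma gauss_momentD P Q :
  gauss_moment (P + Q) = gauss_moment P + gauss_moment Q.
Proof.
by rewrite /gauss_moment gauss_polyD cintegralD//; exact: cintegrable_gauss_poly.
Qed.

Lemma gauss_momentZ (c : R[i]) P :
  gauss_moment (c%:P *: P) = c * gauss_moment P.
Proof.
by rewrite /gauss_moment gauss_polyZ cintegralZ//; exact: cintegrable_gauss_poly.
Qed.

Lemma gauss_moment0 : gauss_moment 0 = 0.
Proof. by rewrite -[X in gauss_moment X](scaler0 _ 0%:P) gauss_momentZ mul0r. Qed.

Lemma gauss_moment_monomial (c : R[i]) i j :
  gauss_moment ((c *: 'X^j) *: 'X^i) = c * (moment a i * moment b j)%:C.
Proof.
have ia := integrable_monomial_gaussian i a0.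
have ib := integrable_monomial_gaussian j b0.
rewrite /gauss_moment gauss_poly_monomial cintegralZ; last first.
  exact: cintegrable_tensor ia ib.
by rewrite (cintegral_tensor ia ib).
Qed.

(** Integration by parts in [Re z]: both sides are linear in [P], and on a monomial the moment
    factors, which leaves the one-dimensional recurrence with parameter [a]. *)
Lemma gauss_moment_steinX P :
  (2 * a)%:C * gauss_moment ('X * P) = gauss_moment P^`().
Proof.
move: P; apply: poly2_ind => [|P Q IP IQ|c i j].
- by rewrite mulr0 deriv0 gauss_moment0 mulr0.
- by rewrite mulrDr derivD !gauss_momentD mulrDr IP IQ.
- rewrite -scalerAr -exprS derivZ derivXn -scalerMnr !scalerMnl.
  have /(congr1 (fun t => t%:C)) := Rintegral_monomial_gaussian_rec j a0.
  rewrite !gauss_moment_monomial -!/(moment _ _) -mulr_natr !rmorphM /=.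
  rewrite !rmorph_nat => E; rewrite [LHS]mulrCA [_ * (_%:C * _%:C)]mulrA E; ring.
Qed.

(** The same argument in [Im z], with parameter [b]. *)
Lemma gauss_moment_steinY P :
  (2 * b)%:C * gauss_moment ('Y * P) = gauss_moment (derivY P).
Proof.
move: P; apply: poly2_ind => [|P Q IP IQ|c i j].
- by rewrite mulr0 /derivY raddf0 gauss_moment0 mulr0.
- by rewrite mulrDr derivYD !gauss_momentD mulrDr IP IQ.
- rewrite derivYZ mul_polyC scalerA -scalerAr -exprS derivZ derivXn.
  rewrite -scalerMnr !scalerMnl.
  have /(congr1 (fun t => t%:C)) := Rintegral_monomial_gaussian_rec i b0.
  rewrite !gauss_moment_monomial -!/(moment _ _) -mulr_natr !rmorphM /=.
  rewrite !rmorph_nat => E.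
  rewrite [LHS]mulrCA [X in _ * X = _]mulrCA E; ring.
Qed.

End GaussianFunctional.

(** * Recurrence and derivative of the Hermite polynomials *)

Section Hermite.
Context {R : realType}.

Lemma horner_poly_inj (p q : {poly R}) : (forall x, p.[x] = q.[x]) -> p = q.
Proof.
move=> pq; apply/eqP; rewrite -subr_eq0; apply/eqP.
(* The first [size (p - q)] natural numbers are distinct roots of [p - q], one more than its degree
   would allow if it were nonzero. *)
apply: (@roots_geq_poly_eq0 _ _ [seq n%:R | n <- iota 0 (size (p - q))]).
- by apply/allP => x _; rewrite /root !hornerE pq subrr.
- by rewrite map_inj_uniq ?iota_uniq// => i j /eqP; rewrite eqr_nat => /eqP.
- by rewrite size_map size_iota.
Qed.

Lemma hermiteP (k : nat) (x : R) : (hermite R k).[x] =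
  (-1) ^+ k * expR (x ^+ 2) * ((fun t : R => expR (- t ^+ 2))^`(k))%classic x.
Proof. by rewrite /hermite; case: cid. Qed.

Lemma derive1n_expRN_sqr (k : nat) :
  ((fun t : R => expR (- t ^+ 2))^`(k))%classic =
  (fun x => (-1) ^+ k * ((hermite R k).[x] * expR (- x ^+ 2))).
Proof.
apply/funext => x; rewrite hermiteP.
by rewrite -!mulrA signrMK mulrCA expRxMexpNx_1 mulr1.
Qed.

Lemma hermite0 : hermite R 0 = 1.
Proof.
apply: horner_poly_inj => x; rewrite hermiteP derive1n0 hornerC expr0 mul1r.
exact: expRxMexpNx_1.
Qed.

(** Differentiating [(-1)^k H_k exp (- x^2)] once more produces the next Rodrigues formula;
    agreement at all real points then gives equality of polynomials. *)
Lemma hermiteS (k : nat) :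
  hermite R k.+1 = 2 *: 'X * hermite R k - (hermite R k)^`().
Proof.
apply: horner_poly_inj => x; rewrite hermiteP derive1nS derive1n_expRN_sqr.
have dg : is_derive x (1 : R) (fun t : R => expR (- t ^+ 2))
    (expR (- x ^+ 2) * (- (2 * x))).
  apply: (is_derive1_comp (f := expR) (g := fun t : R => - t ^+ 2)).
  have -> : (fun t : R => - t ^+ 2) = horner (- 'X^2).
    by apply/funext => t; rewrite !hornerE.
  apply: is_derive_eq.
  by rewrite derivN derivXn !hornerE /= mulr_natl.
have dh := is_deriveZ ((-1) ^+ k) (is_deriveM (is_derive_poly (hermite R k) x) dg).
rewrite derive1E.
have -> : 'D_1 (fun y : R => (-1) ^+ k * ((hermite R k).[y] * expR (- y ^+ 2))) x =
  'D_1 ((-1) ^+ k \*: (horner (hermite R k) * (fun t : R => expR (- t ^+ 2)))) x.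
  by [].
rewrite derive_val /GRing.scale /=.
rewrite hornerD hornerN hornerM hornerZ hornerX [(-1) ^+ k.+1]exprS.
(* Exponentials and sign become variables, so that [ring] works modulo [u v = 1] and [s^2 = 1]. *)
have := expRxMexpNx_1 (x ^+ 2); move: (expR _) (expR _) => u v uv.
have := sqrr_sign R k; move: ((-1) ^+ k) => s ss.
ring: uv ss.
Qed.

(** Differentiate the recurrence, insert the induction hypothesis, and recombine the lower terms by
    the recurrence one index down; this last use makes the first index a separate case. *)
Lemma deriv_hermite (k : nat) :
  (hermite R k)^`() = (2 * k%:R) *: hermite R k.-1.
Proof.
elim: k => [|k IH]; first by rewrite hermite0 derivC mulr0 scale0r.
rewrite hermiteS derivB derivM derivZ derivX IH derivZ /=.
case: k IH => [|k] IH.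
  by rewrite hermite0 !mulr0 !scale0r mulr0 subr0 addr0 !mulr1.
rewrite (hermiteS k) /= -!mul_polyC !polyCM !polyC_natr; ring.
Qed.

End Hermite.

(** * The Gaussian pairing of polynomials in [z] and its conjugate *)

Section Pairing.
Context {R : realType}.
Variables a b : R.
Hypothesis a0 : 0 < a.
Hypothesis b0 : 0 < b.
Implicit Types (F G : {poly R[i]}) (e : R[i]).

(** The linear form [x + e y], which is [z] for [e = i] and the conjugate of [z] for [e = - i]. *)
Definition zline e : {poly {poly R[i]}} := 'X + (e *: 'X)%:P.

(** Conjugation acts on the argument alone, through [- e], and not on the coefficients of [G]; the
    pairing is therefore bilinear. *)
Definition pairing e F G : R[i] :=
  gauss_moment a b ((F^:P \Po zline e) * (G^:P \Po zline (- e))).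

Lemma pairingC e F G : pairing e F G = pairing (- e) G F.
Proof. by rewrite /pairing opprK mulrC. Qed.

Lemma deriv_zline e F : (F^:P \Po zline e)^`() = F^`()^:P \Po zline e.
Proof.
rewrite (derivation_comp_poly (fun P Q => derivD P Q) (fun P Q => derivM P Q)).
  by rewrite derivD derivX derivC addr0 mulr1.
by move=> c; rewrite derivC.
Qed.

Lemma derivY_zline e F :
  derivY (F^:P \Po zline e) = e%:P *: (F^`()^:P \Po zline e).
Proof.
rewrite (derivation_comp_poly (fun P Q => derivYD P Q) (fun P Q => derivYM P Q)).
  rewrite derivYD derivYX add0r derivYC derivZ derivX.
  by rewrite alg_polyC mulrC mul_polyC.
by move=> c; rewrite derivYC derivC.
Qed.

(** The condition on [e] holds for [i] and [- i] alike, so with [pairingC] the recurrence can act on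
    either argument. *)
Lemma pairing_rec e F G : e ^+ 2 = -1 -> a^-1 - b^-1 = 1 ->
  pairing e (2 *: 'X * F - F^`()) G = (a^-1 + b^-1)%:C * pairing e F G^`().
Proof.
move=> e2 ab; rewrite /pairing.
set U := F^:P \Po zline e; set V := G^:P \Po zline (- e).
set U' := F^`()^:P \Po zline e; set V' := G^`()^:P \Po zline (- e).
(* Here [2 (x + e y) U V - U' V] is split into terms with constant coefficients, to which the two
   integrations by parts apply. *)
have -> : ((2 *: 'X * F - F^`())^:P \Po zline e) * V =
  2%:P%:P * ('X * (U * V)) + (2 * e)%:P%:P * ('Y * (U * V)) + (-1)%:P%:P * (U' * V).
  rewrite rmorphB /= rmorphM /= linearZ /= map_polyX comp_polyB comp_polyM.
  rewrite comp_polyZ comp_polyX -/U -/U' /zline -!mul_polyC !polyCM !polyCN.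
  ring.
rewrite (mul_polyC 2%:P) (mul_polyC (2 * e)%:P) (mul_polyC (-1)%:P).
rewrite !gauss_momentD// !gauss_momentZ//.
have X1 := gauss_moment_steinX a0 b0 (U * V).
have Y1 := gauss_moment_steinY a0 b0 (U * V).
have UVx : (U * V)^`() = U' * V + U * V' by rewrite derivM !deriv_zline.
have UVy : derivY (U * V) = e%:P *: (U' * V) + (- e)%:P *: (U * V').
  by rewrite derivYM !derivY_zline -scalerAl -scalerAr.
rewrite UVx gauss_momentD// in X1.
rewrite UVy (gauss_momentD a0 b0) (gauss_momentZ a0 b0 e) in Y1.
rewrite (gauss_momentZ a0 b0 (- e)) in Y1.
move: X1 Y1; set p := gauss_moment _ _ (U' * V).
set q := gauss_moment _ _ (U * V').
set mx := gauss_moment _ _ ('X * _); set my := gauss_moment _ _ ('Y * _).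
move=> X1 Y1.
have mxE : 2 * mx = (a^-1)%:C * (p + q).
  by rewrite -X1 mulrA -rmorphM /= mulrCA mulVf ?gt_eqF// mulr1 rmorph_nat.
have myE : 2 * my = (b^-1)%:C * (e * p + - e * q).
  by rewrite -Y1 mulrA -rmorphM /= mulrCA mulVf ?gt_eqF// mulr1 rmorph_nat.
have abE : (a^-1)%:C = 1 + (b^-1)%:C :> R[i].
  by rewrite -[1]/(1%:C) -rmorphD /= -ab subrK.
(* Since [e^2 = -1], the coefficient of [p] is [1/a - 1/b - 1 = 0], and that of [q] is
   [1/a + 1/b]. *)
rewrite [2 * e]mulrC -mulrA mxE myE rmorphD /= abE.
ring: e2.
Qed.

End Pairing.

(** * Orthogonality of the Hermite polynomials under the pairing *)

Section HermitePairing.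
Context {R : realType}.
Variables a b : R.
Hypothesis a0 : 0 < a.
Hypothesis b0 : 0 < b.
Implicit Types (F G : {poly R[i]}) (e : R[i]).

Local Notation hermitec k := (map_poly (real_complex R) (hermite R k)).

Lemma pairingZr e c F G : pairing a b e F (c *: G) = c * pairing a b e F G.
Proof.
rewrite /pairing -gauss_momentZ//; congr gauss_moment.
by rewrite linearZ /= comp_polyZ -scalerAr.
Qed.

Lemma pairing11 e : pairing a b e 1 1 = (pi / Num.sqrt (a * b))%:C.
Proof.
rewrite /pairing rmorph1 !comp_polyC mul1r.
have -> : 1%:P = (1 *: 'X^0) *: 'X^0 :> {poly {poly R[i]}}.
  by rewrite !expr0 !scale1r.
rewrite gauss_moment_monomial// mul1r; congr (_%:C).
have M0 c : 0 < c -> \int[lebesgue_measure]_x (x ^+ 0 * gaussian c x) =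
    Num.sqrt (pi / c) :> R.
  by move=> c0; under eq_Rintegral do rewrite expr0 mul1r; exact: Rintegral_gaussian.
rewrite !M0// -sqrtrM ?divr_ge0 ?pi_ge0 ?ltW//.
have -> : pi / a * (pi / b) = pi ^+ 2 / (a * b) by field; rewrite !gt_eqF.
by rewrite sqrtrM ?sqr_ge0// sqrtr_sqr ger0_norm ?pi_ge0// sqrtrV// mulr_ge0 ?ltW.
Qed.

(** Each step lowers both indices and contributes [2 (m + 1) (1/a + 1/b)]. If one index reaches zero
    first, the derivative of [H_0] makes the pairing vanish; otherwise the total mass of the weight
    remains. *)
Lemma pairing_hermite e k m : e ^+ 2 = -1 -> a^-1 - b^-1 = 1 ->
  pairing a b e (hermitec k) (hermitec m) =
  ((k == m)%:R * (2 * (a^-1 + b^-1)) ^+ k * k`!%:R * (pi / Num.sqrt (a * b)))%:C.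
Proof.
move=> e2 ab.
have hS j : hermitec j.+1 = 2 *: 'X * hermitec j - (hermitec j)^`().
  by rewrite hermiteS rmorphB rmorphM /= map_polyZ map_polyX deriv_map /= rmorph_nat.
have h' j : (hermitec j)^`() = (2 * j%:R) *: hermitec j.-1.
  by rewrite deriv_map deriv_hermite map_polyZ /= rmorphM !rmorph_nat.
elim: k m e e2 => [|k IH] [|m] e e2.
- by rewrite hermite0 rmorph1 pairing11 expr0 fact0 !mul1r.
(* Swapping the arguments, with [- e] in place of [e], lets the recurrence act on [H_(m+1)] and
   differentiate [H_0]. *)
- rewrite pairingC hS pairing_rec ?sqrrN// h' pairingZr !(mulr0, mul0r).
  by rewrite rmorph0.
- by rewrite hS pairing_rec// h' pairingZr !(mulr0, mul0r) rmorph0.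
- rewrite hS pairing_rec// h' pairingZr IH// eqSS.
  case: eqP => [->|_]; last by rewrite /= !mul0r !mulr0 rmorph0.
  by rewrite factS exprS natrM !rmorphM !rmorph_nat; ring.
Qed.

Lemma horner_zline e F x y : (F^:P \Po zline e).[x, y] = F.[x + e * y].
Proof.
rewrite horner_comp /zline hornerD hornerX hornerC -/(comp_poly _ _).
by rewrite horner_comp hornerD hornerC hornerZ hornerX.
Qed.

(** The coefficients of [H_m] are real, so its value at the conjugate of [z] is the conjugate of its
    value at [z]. *)
Lemma gauss_poly_hermite k m :
  gauss_poly a b (((hermitec k)^:P \Po zline 'i) * ((hermitec m)^:P \Po zline (- 'i))) =
  fun z => hermiteC k z * (hermiteC m z)^* * (gauss_weight a b z)%:C.
Proof.
apply/funext => z; rewrite /gauss_poly !hornerM !horner_zline; congr (_ * _ * _).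
  by rewrite -complexE.
rewrite /hermiteC -(horner_map conjc) /= -map_poly_comp.
congr (_.[_]).
  by apply: eq_map_poly => x /=; rewrite oppr0.
by case: z => x y; apply/eqP; rewrite eq_complex /=; apply/andP; split; apply/eqP; ring.
Qed.

End HermitePairing.

(** * Specialization of the weight to the parameter [theta] *)

Theorem mainTheorem5 (R : realType) (theta : R) (theta_gt1 : 1 < theta)
    (k m : nat) :
  let f := fun z : R[i] =>
    hermiteC k z * (hermiteC m z)^*
    * (expR (- (2 * complex.Re z ^+ 2 / (theta + 1))
             - 2 * complex.Im z ^+ 2 / (theta - 1)))%:C in
  cintegrable f /\
  (2 / Num.sqrt (theta ^+ 2 - 1))%:C * cintegral f
  = ((k == m)%:R * pi * (2 * theta) ^+ k * k`!%:R)%:C.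
Proof.
move=> f.
have t1 : 0 < theta + 1 by rewrite addr_gt0// (lt_trans ltr01).
have t2 : 0 < theta - 1 by rewrite subr_gt0.
pose a := 2 / (theta + 1); pose b := 2 / (theta - 1).
have a0 : 0 < a by rewrite divr_gt0.
have b0 : 0 < b by rewrite divr_gt0.
have fE : f = gauss_poly a b
    (((map_poly (real_complex R) (hermite R k))^:P \Po zline 'i) *
     ((map_poly (real_complex R) (hermite R m))^:P \Po zline (- 'i))).
  rewrite gauss_poly_hermite; apply/funext => z; congr (_ * _%:C).
  rewrite /gauss_weight /gaussian -expRD; congr expR.
  have assoc (u c : R) : 2 * u / c = 2 / c * u by rewrite mulrAC.
  by rewrite !assoc.
rewrite fE; split; first exact: cintegrable_gauss_poly.
rewrite -/(gauss_moment _ _ _) -/(pairing _ _ _ _ _).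
rewrite (pairing_hermite a0 b0) ?sqr_i//; last by rewrite !invf_div; field.
rewrite -rmorphM /=; congr (_%:C).
have -> : a^-1 + b^-1 = theta by rewrite !invf_div; field.
(* Hence the mass [pi / sqrt (a b)] equals [pi sqrt (theta^2 - 1) / 2], which the prefactor of the
   integral reduces to [pi]. *)
have -> : a * b = 2 ^+ 2 / (theta ^+ 2 - 1).
  rewrite /a /b; field; rewrite !gt_eqF//.
  by rewrite subr_gt0 expr_gt1// ltW// (lt_trans ltr01).
have s0 : 0 < theta ^+ 2 - 1 by rewrite subr_gt0 expr_gt1// ltW// (lt_trans ltr01).
rewrite sqrtrM ?sqr_ge0// sqrtr_sqr ger0_norm// sqrtrV ?ltW//.
field.
by rewrite gt_eqF// sqrtr_gt0.
Qed.
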